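(* Let $N,B\geq 1$ and $d$ be integers with $N\le d\le N(B-1)$, let $L=NB$, and let $$\mathcal{S}_B^d=\{I_L\}\cup\{T_1,\ldots,T_d\}\cup\{\tilde T_1,\ldots,\tilde T_d\}$$ be the basis of the space of $d$-banded $L\times L$ Hermitian Toeplitz matrices. Then the set $$\mathcal{K}=\{m+bN:\ m\in\mathcal{M},\ b=0,1,\ldots,B-1\},$$ where $\mathcal{M}\subset\{0,\ldots,N-1\}$, defines an $\mathcal{S}_B^d$-covariance sampler if and only if $\mathcal{M}$ is a length-$(N-1)$ circular sparse ruler.
   Context: Let $J_L$ be the $L\times L$ matrix whose $(m,n)$ entry is $1$ if $n-m=1$ and $0$ otherwise (indices start at $0$). For $l\ge 1$, $T_l=J_L^l+(J_L^l)^T$ and $\tilde T_l=\jmath J_L^l-\jmath(J_L^l)^T$, with $\jmath$ the imaginary unit. A matrix is $d$-banded if its $(i,j)$ entry is zero whenever $|i-j|>d$. For integers $x$ and $A\ge1$, $(x)_A$ denotes the remainder in $\{0,\ldots,A-1\}$ of $x$ modulo $A$. The $A$-modular difference set of a set $\mathcal{A}$ of integers is $\Delta_A(\mathcal{A})=\{\delta\ge 0:\ \exists a_1,a_2\in\mathcal{A}\text{ such that }\delta=(a_2-a_1)_A\}$. A length-$(N-1)$ circular sparse ruler is a set $\mathcal{M}\subset\{0,\ldots,N-1\}$ satisfying $\Delta_N(\mathcal{M})=\{0,\ldots,N-1\}$. Covariance samplers: given a linearly independent set (over $\mathbb{R}$) $\mathcal{S}$ of $L\times L$ Hermitian Toeplitz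 matrices, a matrix $\bar\Phi\in\mathbb{C}^{K\times L}$ defines an $\mathcal{S}$-covariance sampler if the map $\phi:\mathrm{span}_{\mathbb{R}}\,\mathcal{S}\to\mathrm{span}_{\mathbb{R}}\{\bar\Phi\Sigma_s\bar\Phi^H:\Sigma_s\in\mathcal{S}\}$, $\phi(\Sigma)=\bar\Phi\Sigma\bar\Phi^H$, is invertible. A set $\mathcal{K}\subset\{0,\ldots,L-1\}$ is said to define an $\mathcal{S}$-covariance sampler if the (sparse) matrix $\bar\Phi\in\mathbb{C}^{|\mathcal{K}|\times L}$ formed by the rows of $I_L$ with indices in $\mathcal{K}$ (in increasing order) does. *)

(* Defs.v *)
From mathcomp Require Export all_boot all_order all_algebra.
From mathcomp Require Export spectral.
From mathcomp Require Export boolp classical_sets functions reals.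
From mathcomp.real_closed Require Export complex.
From mathcomp Require Import zify lra.

Set Implicit Arguments.
Unset Strict Implicit.
Unset Printing Implicit Defensive.

Import Order.TTheory GRing.Theory Num.Theory.

Local Open Scope classical_set_scope.
Local Open Scope ring_scope.
Local Open Scope sesquilinear_scope.
Local Open Scope complex_scope.

Section RealSpan.
Variables (R : realType) (m n : nat).
Implicit Types S : set 'M[R[i]]_(m, n).

(* Complex matrices are only declared as a module over R[i] in the library, so
   real scalars act through the embedding c |-> c%:C. *)
Definition rspan S : set 'M[R[i]]_(m, n) :=
  [set X | exists (k : nat) (c : 'I_k -> R) (A : 'I_k -> 'M[R[i]]_(m, n)),
    (forall i, S (A i)) /\ X = \sum_(i < k) (c i)%:C *: A i].

Definition rlin_indep S : Prop :=
  forall (k : nat) (c : 'I_k -> R) (A : 'I_k -> 'M[R[i]]_(m, n)),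
    injective A -> (forall i, S (A i)) ->
    \sum_(i < k) (c i)%:C *: A i = 0 -> forall i, c i = 0.

End RealSpan.

Section HermitianToeplitz.
Variables (R : realType) (L : nat).
Implicit Types (A : 'M[R[i]]_L) (l d : nat).

Definition hermitian A : Prop := A ^t* = A.

(* i - j = k - l, written without truncated subtraction *)
Definition toeplitz A : Prop :=
  forall i j k l : 'I_L, (i + l = k + j)%N -> A i j = A k l.

Definition banded d A : Prop :=
  forall i j : 'I_L, (i + d < j)%N || (j + d < i)%N -> A i j = 0.

Definition shift_mx : 'M[R[i]]_L := \matrix_(m, n) (n == m.+1 :> nat)%:R.

Definition T_mx l : 'M[R[i]]_L := shift_mx ^+ l + (shift_mx ^+ l)^T.

Definition Tt_mx l : 'M[R[i]]_L :=
  'i%C *: shift_mx ^+ l - 'i%C *: (shift_mx ^+ l)^T.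

Definition banded_basis d : set 'M[R[i]]_L :=
  [set 1%:M] `|` [set T_mx l | l in [set l | (1 <= l <= d)%N]]
             `|` [set Tt_mx l | l in [set l | (1 <= l <= d)%N]].

End HermitianToeplitz.

Arguments shift_mx R L : clear implicits.
Arguments T_mx R L l : clear implicits.
Arguments Tt_mx R L l : clear implicits.
Arguments banded_basis R L d : clear implicits.

Section CovarianceSampler.
Variables (R : realType) (L : nat).

(* Meant for rlin_indep sets S of hermitian toeplitz matrices; banded_basisP
   below shows that banded_basis is one. *)
Definition covariance_sampler (S : set 'M[R[i]]_L) (K : nat)
    (Phi : 'M[R[i]]_(K, L)) : Prop :=
  let phi (X : 'M[R[i]]_L) := Phi *m X *m Phi ^t* in
  set_bij (rspan S) (rspan (phi @` S)) phi.

(* enum_val lists the elements of K in increasing order *)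
Definition row_selection (K : {set 'I_L}) : 'M[R[i]]_(#|K|, L) :=
  rowsub (fun i : 'I_#|K| => enum_val i) 1%:M.

Definition set_covariance_sampler (S : set 'M[R[i]]_L) (K : {set 'I_L}) : Prop :=
  covariance_sampler S (row_selection K).

End CovarianceSampler.

Definition mod_diff_set (A : nat) (X : set int) : set int :=
  [set delta | 0 <= delta /\
    exists a1 a2, [/\ X a1, X a2 & delta = ((a2 - a1) %% A)%Z]].

Definition circular_sparse_ruler (N : nat) (M : {set 'I_N}) : Prop :=
  mod_diff_set N [set (m : nat)%:Z | m in [set` M]] =
  [set delta : int | 0 <= delta < N%:Z].

Definition periodic_set (N B : nat) (M : {set 'I_N}) : {set 'I_(N * B)} :=
  [set k : 'I_(N * B) | [exists m in M, [exists b : 'I_B,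
    k == (m + b * N)%N :> nat]]]%SET.

Section BandedBasis.
Variables (R : realType).

Lemma shift_mxXE L l (i j : 'I_L) :
  (shift_mx R L ^+ l) i j = (j == (i + l)%N :> nat)%:R.
Proof.
elim: l i j => [|l IH] i j; first by rewrite expr0 mxE addn0 eq_sym.
rewrite exprS mxE.
under eq_bigr => k _ do rewrite IH mxE -natrM mulnb.
rewrite -natr_sum; congr (_%:R).
have [hj|hj] := eqVneq (j : nat) (i + l.+1)%N; last first.
  by rewrite big1 // => k _; case: eqP => // ->; rewrite addSnnS (negbTE hj).
have hi : (i.+1 < L)%N.
  by rewrite (leq_ltn_trans _ (ltn_ord j)) // hj addnS ltnS leq_addr.
rewrite (bigD1 (Ordinal hi)) //= eqxx addSnnS hj eqxx big1 // => k.
by rewrite -val_eqE /= => /negbTE ->.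
Qed.

Lemma T_mxE L l (i j : 'I_L) : T_mx R L l i j =
  (j == (i + l)%N :> nat)%:R + (i == (j + l)%N :> nat)%:R.
Proof. by rewrite /T_mx !mxE !shift_mxXE. Qed.

Lemma Tt_mxE L l (i j : 'I_L) : Tt_mx R L l i j =
  'i%C * ((j == (i + l)%N :> nat)%:R - (i == (j + l)%N :> nat)%:R).
Proof. by rewrite /Tt_mx !mxE !shift_mxXE mulrBr. Qed.

Lemma hermitianP L (A : 'M[R[i]]_L) :
  hermitian A <-> forall i j, Num.conj (A j i) = A i j.
Proof.
split=> [hA i j|hA]; first by rewrite -[in RHS]hA !mxE.
by apply/matrixP => i j; rewrite !mxE.
Qed.

Lemma conj_realC (x : R) : Num.conj (x%:C : R[i]) = x%:C.
Proof. by apply/eqP; rewrite eq_complex /= oppr0 !eqxx. Qed.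

Lemma conj_iC : Num.conj ('i%C : R[i]) = - 'i%C.
Proof. by apply/eqP; rewrite eq_complex /= oppr0 !eqxx. Qed.

Lemma banded_basis_dual L d : (d < L)%N ->
  forall A : 'M[R[i]]_L, banded_basis R L d A ->
  exists (z : R[i]) (i j : 'I_L), complex.Re (z * A i j) = 1 /\
    forall X, banded_basis R L d X -> X != A -> complex.Re (z * X i j) = 0.
Proof.
case: L => // L dL.
have E1 (k : 'I_L.+1) : (1%:M : 'M[R[i]]_L.+1) ord0 k = (k == 0%N :> nat)%:R.
  by rewrite mxE eq_sym.
have ET l (k : 'I_L.+1) : (1 <= l <= d)%N ->
    T_mx R L.+1 l ord0 k = (k == l :> nat)%:R.
  case/andP=> l0 _; rewrite T_mxE add0n /= [(0 == _)%N]eq_sym addn_eq0.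
  by rewrite -[l == 0%N]negbK -lt0n l0 andbF addr0.
have Et l (k : 'I_L.+1) : (1 <= l <= d)%N ->
    Tt_mx R L.+1 l ord0 k = 'i%C * (k == l :> nat)%:R.
  case/andP=> l0 _; rewrite Tt_mxE add0n /= [(0 == _)%N]eq_sym addn_eq0.
  by rewrite -[l == 0%N]negbK -lt0n l0 andbF subr0.
have Rei (b : bool) : complex.Re ('i%C * b%:R : R[i]) = 0.
  by case: b; rewrite ?mulr1 ?mulr0.
have Reii (b : bool) : complex.Re (- 'i%C * ('i%C * b%:R) : R[i]) = b%:R.
  by rewrite mulrA mulNr -expr2 sqr_i opprK mul1r; case: b.
have Rein (b : bool) : complex.Re (- 'i%C * b%:R : R[i]) = 0.
  by rewrite mulNr; case: b; rewrite ?mulr1 ?mulr0 ?oppr0 //= oppr0.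
move=> A [[->|[l hl <-]]|[l hl <-]].
- exists 1, ord0, ord0; rewrite mul1r E1; split => // X.
  move=> [[->|[l' hl' <-]]|[l' hl' <-]]; first by rewrite eqxx.
    by move=> _; rewrite mul1r ET //=; case: l' hl'.
  by move=> _; rewrite mul1r Et.
- have hlL : (l < L.+1)%N by case/andP: hl => _ /leq_ltn_trans; apply.
  exists 1, ord0, (Ordinal hlL); rewrite mul1r ET //= eqxx; split => // X.
  move=> [[->|[l' hl' <-]]|[l' hl' <-]] ne.
  + by rewrite mul1r E1 /=; case: l hl {hlL ne}.
  + by rewrite mul1r ET //=; case: (l =P l') => // e; rewrite e eqxx in ne.
  + by rewrite mul1r Et.
- have hlL : (l < L.+1)%N by case/andP: hl => _ /leq_ltn_trans; apply.
  exists (- 'i%C), ord0, (Ordinal hlL); rewrite Et // Reii /= eqxx; split => // X.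
  move=> [[->|[l' hl' <-]]|[l' hl' <-]] ne.
  + by rewrite E1 Rein.
  + by rewrite ET // Rein.
  + by rewrite Et // Reii /=; case: (l =P l') => // e; rewrite e eqxx in ne.
Qed.

Lemma banded_basis_indep L d : (d < L)%N -> rlin_indep (banded_basis R L d).
Proof.
move=> dL k c A injA SA sum0 i0.
have [z [i [j [f1 f0]]]] := banded_basis_dual dL (SA i0).
have := congr1 (fun X : 'M[R[i]]_L => complex.Re (z * X i j)) sum0.
rewrite summxE mxE mulr0 mulr_sumr raddf_sum /=.
under eq_bigr => h _.
  rewrite mxE mulrCA.
  have -> (w : R[i]) : complex.Re ((c h)%:C * w) = c h * complex.Re w.
    by case: w => u v /=; rewrite mul0r subr0.
  over.
rewrite (bigD1 i0) //= f1 mulr1 big1 ?addr0 // => h hne.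
by rewrite f0 ?mulr0 //; apply: contra hne => /eqP /injA ->.
Qed.

Lemma rspan_sub m n (S : set 'M[R[i]]_(m, n)) : S `<=` rspan S.
Proof.
move=> X SX; exists 1%N, (fun=> 1), (fun=> X); split => //.
by rewrite big_ord1 scale1r.
Qed.

Lemma rspanZ m n (S : set 'M[R[i]]_(m, n)) (a : R) X :
  rspan S X -> rspan S (a%:C *: X).
Proof.
move=> [k [c [A [SA ->]]]]; exists k, (fun i => a * c i), A; split => //.
by rewrite scaler_sumr; apply: eq_bigr => i _; rewrite scalerA rmorphM.
Qed.

Lemma rspanD m n (S : set 'M[R[i]]_(m, n)) X Y :
  rspan S X -> rspan S Y -> rspan S (X + Y).
Proof.
move=> [k [c [A [SA ->]]]] [k' [c' [A' [SA' ->]]]].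
exists (k + k')%N.
exists (fun i => match fintype.split i with inl j => c j | inr j => c' j end).
exists (fun i => match fintype.split i with inl j => A j | inr j => A' j end).
split; first by move=> i; case: fintype.split.
rewrite big_split_ord /=; congr (_ + _); apply: eq_bigr => i _.
  by rewrite (unsplitK (inl i)).
by rewrite (unsplitK (inr i)).
Qed.

Lemma rspan0 m n (S : set 'M[R[i]]_(m, n)) : rspan S 0.
Proof.
exists 0%N, (fun=> 0), (fun=> 0); split; first by case.
by rewrite big_ord0.
Qed.

Lemma banded_basis_span L d : (d < L)%N ->
  rspan (banded_basis R L d) =
  [set A : 'M[R[i]]_L | [/\ banded d A, hermitian A & toeplitz A]].
Proof.
case: L => // L dL; apply/seteqP; split => X.
  move=> [k [c [A [SA ->]]]].
  have PA h : [/\ banded d (A h), hermitian (A h) & toeplitz (A h)].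
    case: (SA h) => [[->|[l /andP[l0 ld] <-]]|[l /andP[l0 ld] <-]]; split.
    - move=> i j hij; rewrite mxE; case: eqP hij => // ->.
      by rewrite -ltn_subRL subnn ltn0.
    - apply/hermitianP => i j; rewrite !mxE eq_sym; exact: rmorph_nat.
    - by move=> i j k' l e; rewrite !mxE -!val_eqE; congr (_%:R); congr nat_of_bool; rewrite /=; lia.
    - move=> i j hij; rewrite T_mxE.
      have -> : (j == (i + l)%N :> nat) = false by lia.
      have -> : (i == (j + l)%N :> nat) = false by lia.
      by rewrite addr0.
    - apply/hermitianP => i j; rewrite !T_mxE rmorphD.
      by rewrite !rmorph_nat addrC.
    - move=> i j k' l' e; rewrite !T_mxE; congr (_%:R + _%:R); congr nat_of_bool; lia.
    - move=> i j hij; rewrite Tt_mxE.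
      have -> : (j == (i + l)%N :> nat) = false by lia.
      have -> : (i == (j + l)%N :> nat) = false by lia.
      by rewrite subr0 mulr0.
    - apply/hermitianP => i j; rewrite !Tt_mxE rmorphM rmorphB.
      rewrite /= !rmorph_nat.
      by rewrite conj_iC mulNr -mulrN opprB.
    - move=> i j k' l' e; rewrite !Tt_mxE; congr (_ * (_%:R - _%:R)); congr nat_of_bool; lia.
  split.
  - move=> i j hij; rewrite summxE big1 // => h _; rewrite mxE.
    by have [-> //] := PA h; rewrite mulr0.
  - apply/hermitianP => i j; rewrite !summxE rmorph_sum /=.
    apply: eq_bigr => h _; have [_ /hermitianP hh _] := PA h.
    by rewrite !mxE rmorphM /= hh conj_realC.
  - move=> i j k' l e; rewrite !summxE; apply: eq_bigr => h _.
    by rewrite !mxE; have [_ _ /(_ _ _ _ _ e) ->] := PA h.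
move=> [bX hX tX].
have hX' i j : X j i = Num.conj (X i j) by rewrite (hermitianP X).1.
pose a (k : nat) : R[i] := X ord0 (inord k).
have aE (i j : 'I_L.+1) : (i <= j)%N -> X i j = a (j - i)%N.
  move=> ij; apply: tX; rewrite /= inordK; first lia.
  by have := ltn_ord j; lia.
have -> : X = (complex.Re (a 0%N))%:C *: 1%:M
    + \sum_(h < d) ((complex.Re (a h.+1))%:C *: T_mx R L.+1 h.+1
                  + (complex.Im (a h.+1))%:C *: Tt_mx R L.+1 h.+1).
  have up (i j : 'I_L.+1) : (i <= j)%N -> X i j =
      ((complex.Re (a 0%N))%:C *: 1%:M
    + \sum_(h < d) ((complex.Re (a h.+1))%:C *: T_mx R L.+1 h.+1
                  + (complex.Im (a h.+1))%:C *: Tt_mx R L.+1 h.+1)) i j.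
    move=> ij; rewrite aE // mxE summxE.
    under eq_bigr => h _.
      rewrite mxE [X in X + _]mxE [X in _ + X]mxE T_mxE Tt_mxE.
      have -> : (i == (j + h.+1)%N :> nat) = false by lia.
      rewrite addr0 subr0 [_ * ('i%C * _)]mulrA -mulrDl [_ * 'i%C]mulrC -complexE.
      over.
    rewrite mxE mxE -val_eqE.
    case: (eqVneq (i : nat) j) => [e|ne].
      rewrite mulr1 big1 ?addr0; last first.
        move=> h _; have -> : (j == (i + h.+1)%N :> nat) = false by lia.
        by rewrite mulr0.
      rewrite e subnn.
      have : X ord0 ord0 = Num.conj (X ord0 ord0) by rewrite -hX'.
      have -> : X ord0 ord0 = a 0%N by rewrite aE.
      by case: (a 0%N) => u v [] /=; rewrite /conjc /= => vE; congr Complex; lra.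
    rewrite mulr0 add0r.
    case: (leqP (j - i)%N d) => hd.
      have hp : ((j - i).-1 < d)%N by lia.
      rewrite (bigD1 (Ordinal hp)) //= big1.
        have -> : (j - i).-1.+1 = (j - i)%N by lia.
        have -> : (j == (i + (j - i))%N :> nat) by lia.
        by rewrite mulr1 addr0.
      move=> h; rewrite -val_eqE /= => hne.
      have -> : (j == (i + h.+1)%N :> nat) = false by lia.
      by rewrite mulr0.
    rewrite big1; last first.
      move=> h _; have := ltn_ord h => hh.
      have -> : (j == (i + h.+1)%N :> nat) = false by lia.
      by rewrite mulr0.
    by rewrite -aE // bX //; lia.
  apply/matrixP => i j; case: (leqP i j) => [|/ltnW] ij; first exact: up.
  rewrite hX' up // !mxE !summxE rmorphD rmorph_sum /=; congr (_ + _).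
    by rewrite rmorphM /= rmorph_nat eq_sym conj_realC.
  apply: eq_bigr => h _.
  have tE (p q : 'I_L.+1) (u v : R) (U V : 'M[R[i]]_L.+1) :
    (u%:C *: U + v%:C *: V) p q = u%:C * U p q + v%:C * V p q by rewrite !mxE.
  rewrite !tE rmorphD !rmorphM !T_mxE !Tt_mxE /=.
  rewrite !conj_realC rmorphD rmorphM rmorphB /= conj_iC !rmorph_nat; congr (_ * _ + _ * _).
    by rewrite addrC.
  by rewrite mulNr -mulrN opprB.
apply: rspanD; first by apply/rspanZ/rspan_sub; left; left.
apply: (big_ind (rspan (banded_basis R L.+1 d))).
- exact: rspan0.
- by move=> ? ?; apply: rspanD.
move=> h _; apply: rspanD; apply/rspanZ/rspan_sub.
  by left; right; exists h.+1 => //=.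
by right; exists h.+1 => //=.
Qed.

Lemma banded_basisP L d : (d < L)%N ->
  rlin_indep (banded_basis R L d) /\
  rspan (banded_basis R L d) =
  [set A : 'M[R[i]]_L | [/\ banded d A, hermitian A & toeplitz A]].
Proof.
by move=> dL; split; [exact: banded_basis_indep | exact: banded_basis_span].
Qed.

End BandedBasis.

(* Main.v *)
(** Both sides amount to conditions on differences.  Compressing by a row selection
    [K] keeps the entries of [X] indexed by [K * K], and a [d]-banded Hermitian
    Toeplitz matrix is determined by its entries at lags [0, ..., d]; so [K] is a
    sampler iff every lag [l <= d] is a difference of two elements of [K].  For
    the periodic set, write [l = q N + r].  A pair of marks realizing [r] modulo [N]
    has [m2 - m1 = r] or [m2 - m1 = r - N], and [l] is obtained by putting [m2] in
    period [q] or [q + 1]; the bound [d <= N (B - 1)] makes that period available. *)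
Require Import Defs.
From mathcomp Require Import zify.

Set Implicit Arguments.
Unset Strict Implicit.
Unset Printing Implicit Defensive.

Import Order.TTheory GRing.Theory Num.Theory.

Local Open Scope classical_set_scope.
Local Open Scope ring_scope.
Local Open Scope sesquilinear_scope.
Local Open Scope complex_scope.

Definition has_lag (L : nat) (K : {set 'I_L}) (l : nat) : Prop :=
  exists i j : 'I_L, [/\ i \in K, j \in K & j = (i + l)%N :> nat].

Section RowSelection.
Variables (R : realType) (L : nat).

Lemma row_selectionE (K : {set 'I_L}) (X : 'M[R[i]]_L) p q :
  (row_selection R K *m X *m (row_selection R K) ^t*) p q =
  X (enum_val p) (enum_val q).
Proof.
have -> : row_selection R K *m X = rowsub (fun i : 'I_#|K| => enum_val i) X.
  by rewrite /row_selection mul_rowsub_mx mul1mx.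
rewrite mxE (bigD1 (enum_val q)) //= !mxE eqxx rmorph1 mulr1 big1 ?addr0 // => k kq.
by rewrite !mxE eq_sym (negbTE kq) rmorph0 mulr0.
Qed.

(** Compression is real-linear, so it always carries the span of [S] onto the span of the images;
    only injectivity is at stake. *)
Lemma covariance_samplerP (S : set 'M[R[i]]_L) k (Phi : 'M[R[i]]_(k, L)) :
  covariance_sampler S Phi <->
  set_inj (rspan S) (fun X => Phi *m X *m Phi ^t*).
Proof.
have phi_sum n (c : 'I_n -> R) (A : 'I_n -> 'M[R[i]]_L) :
    Phi *m (\sum_(h < n) (c h)%:C *: A h) *m Phi ^t* =
    \sum_(h < n) (c h)%:C *: (Phi *m A h *m Phi ^t*).
  rewrite mulmx_sumr mulmx_suml; apply: eq_bigr => h _.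
  by rewrite -scalemxAr -scalemxAl.
split=> [[]//|phi_inj]; split=> //.
  move=> X [n [c [A [SA ->]]]]; exists n, c, (fun h => Phi *m A h *m Phi ^t*).
  by split=> // h; exists (A h).
move=> Y [n [c [Z [SZ ->]]]].
pose A h := projT1 (cid2 (SZ h)).
have AE h : S (A h) /\ Phi *m A h *m Phi ^t* = Z h.
  by rewrite /A; case: (cid2 (SZ h)).
exists (\sum_(h < n) (c h)%:C *: A h).
  by exists n, c, A; split=> // h; have [] := AE h.
by rewrite phi_sum; apply: eq_bigr => h _; have [_ ->] := AE h.
Qed.

(** Membership goes through the description of the span so as to include [l = 0], where [T_mx R L 0]
    is twice the identity rather than a basis element. *)
Lemma T_mx_span d l : (d < L)%N -> (l <= d)%N ->
  rspan (banded_basis R L d) (T_mx R L l).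
Proof.
move=> dL ld; rewrite banded_basis_span //; split.
- move=> i j ij; rewrite T_mxE.
  have -> : (j == (i + l)%N :> nat) = false by lia.
  have -> : (i == (j + l)%N :> nat) = false by lia.
  by rewrite addr0.
- by apply/hermitianP => i j; rewrite !T_mxE rmorphD /= !rmorph_nat addrC.
- move=> i j i' j' e; rewrite !T_mxE.
  by congr (_%:R + _%:R); congr nat_of_bool; lia.
Qed.

Lemma set_covariance_samplerP d (K : {set 'I_L}) : (d < L)%N ->
  set_covariance_sampler (banded_basis R L d) K <->
  forall l, (l <= d)%N -> has_lag K l.
Proof.
move=> dL; rewrite /set_covariance_sampler covariance_samplerP; split.
  move=> phi_inj l ld; apply: contrapT => nolag.
  have lL := leq_ltn_trans ld dL.
  have L0 : (0 < L)%N by lia.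
  (* If no two elements of [K] differ by [l], compression kills [T_mx R L l], which is supported at
     differences [l] and [-l]. Its entry at [(0, l)] is 1, or 2 when [l = 0], a contradiction. *)
  have /(congr1 (fun X : 'M_L => X (Ordinal L0) (Ordinal lL))) :
      T_mx R L l = 0.
    apply: phi_inj; rewrite ?inE; [exact: T_mx_span | exact: rspan0 |].
    apply/matrixP => p q; rewrite !row_selectionE T_mxE mxE.
    case: eqP => [e|_]; last case: eqP => [e|_]; last by rewrite addr0.
    - by case: nolag; exists (enum_val p), (enum_val q); rewrite !enum_valP.
    - by case: nolag; exists (enum_val q), (enum_val p); rewrite !enum_valP.
  rewrite T_mxE mxE /= add0n eqxx -natrD => /eqP.
  by rewrite pnatr_eq0.
move=> lags X Y; rewrite !inE banded_basis_span //.
move=> [bX /hermitianP hX tX] [bY /hermitianP hY tY] phiXY.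
(* Hermitian symmetry leaves the entries on and above the diagonal. Within the band, the Toeplitz
   property moves [(i, j)] to a pair [(p, q)] of elements of [K], where the compressions agree. *)
have XY_upper (i j : 'I_L) : (i <= j)%N -> X i j = Y i j.
  move=> ij; have [ld|dl] := leqP (j - i)%N d; last by rewrite bX ?bY //; lia.
  have [p [q [pK qK pq]]] := lags _ ld.
  rewrite (tX i j p q) ?(tY i j p q); try lia.
  have /matrixP/(_ (enum_rank_in pK p) (enum_rank_in pK q)) := phiXY.
  by rewrite !row_selectionE !enum_rankK_in.
apply/matrixP => i j; case: (leqP i j) => [|/ltnW] ij; first exact: XY_upper.
by rewrite -hX -hY XY_upper.
Qed.

End RowSelection.

Section PeriodicSet.
Variables (N B : nat) (M : {set 'I_N}).

Lemma periodic_setP (k : 'I_(N * B)) :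
  reflect (exists2 m : 'I_N, m \in M &
             exists2 b, (b < B)%N & k = (m + b * N)%N :> nat)
          (k \in periodic_set B M).
Proof.
rewrite inE; apply: (iffP existsP) => [[m /andP[mM /existsP[b /eqP e]]]|].
  by exists m => //; exists b.
move=> [m mM [b bB e]]; exists m; rewrite mM /=.
by apply/existsP; exists (Ordinal bB); apply/eqP.
Qed.

(** Remainders modulo [N] lie in the range automatically, so the set equality amounts to every
    residue being attained. *)
Lemma circular_sparse_rulerP : (0 < N)%N ->
  circular_sparse_ruler M <->
  forall r, (r < N)%N -> exists m1 m2 : 'I_N,
    [/\ m1 \in M, m2 \in M & m2 = (m1 + r)%N %[mod N]].
Proof.
move=> N0; have modzE (m1 m2 : 'I_N) r : (r < N)%N ->
    r%:Z = ((m2%:Z - m1%:Z) %% N)%Z <-> m2 = (m1 + r)%N %[mod N].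
  move=> rN; split=> [e|e].
    apply/eqP; rewrite -eqz_nat -!modz_nat PoszD e modzDmr.
    by rewrite addrC subrK.
  have e' : (m2 = m1%:Z + r%:Z %[mod N])%Z by rewrite -PoszD !modz_nat e.
  by rewrite -modzDml e' modzDml addrAC subrr add0r modz_small //; lia.
split=> [ruler r rN|marks].
  have : [set delta : int | 0 <= delta < N%:Z] r%:Z by rewrite /=; lia.
  rewrite -ruler => -[_ [_ [_ [[m1 m1M <-] [m2 m2M <-] /(modzE _ _ _ rN) e]]]].
  by exists m1, m2.
apply/seteqP; split=> [delta [delta0 [a1 [a2 [_ _ e]]]]|delta /= deltaN].
  by rewrite /= delta0 e ltz_pmod.
have [r rE] : exists r : nat, delta = r%:Z by exists `|delta|%N; lia.
subst delta; have rN : (r < N)%N by lia.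
have [m1 [m2 [m1M m2M /(modzE _ _ _ rN) e]]] := marks r rN.
by split=> //; exists m1%:Z, m2%:Z; split=> //; [exists m1 | exists m2].
Qed.

Lemma periodic_set_lags d : (0 < N)%N -> (0 < B)%N ->
  (N <= d <= N * (B - 1))%N ->
  (forall l, (l <= d)%N -> has_lag (periodic_set B M) l) <->
  circular_sparse_ruler M.
Proof.
move=> N0 B0 /andP[Nd dB]; rewrite circular_sparse_rulerP //; split.
  (* Since [N <= d], each residue is itself an available lag; reducing modulo [N] then erases the
     periods. *)
  move=> lags r rN; have rd : (r <= d)%N by lia.
  have [i [j [iK jK e]]] := lags r rd.
  have [m1 m1M [b1 _ iE]] := periodic_setP _ iK.
  have [m2 m2M [b2 _ jE]] := periodic_setP _ jK.
  rewrite iE jE in e.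
  exists m1, m2; split=> //.
  by rewrite -(modnMDl b2 m2) addnC e -(modnMDl b1 (m1 + r)) addnCA addnA.
move=> marks l ld.
have [m1 [m2 [m1M m2M e]]] := marks (l %% N)%N (ltn_pmod l N0).
have [[m1N m2N] rN] := (ltn_ord m1, ltn_ord m2, ltn_pmod l N0).
have lE := divn_eq l N.
move: (l %/ N)%N (l %% N)%N => q r in e rN lE.
have qN : (q * N <= (B - 1) * N)%N by lia.
have [b bB jE] : exists2 b, (b < B)%N & (m2 + b * N)%N = (m1 + l)%N.
  have [nowrap|wrap] := ltnP (m1 + r)%N N.
    have e' : m2 = (m1 + r)%N :> nat by move: e; rewrite !modn_small.
    exists q; last by lia.
    by move: qN; rewrite leq_pmul2r //; lia.
  have e' : (m2 + N)%N = (m1 + r)%N.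
    by move: e; rewrite -(subnK wrap) modnDr !modn_small; lia.
  exists q.+1; last by lia.
  (* Wrapping forces [r > 0] because [m1 < N]. Hence [q * N < l <= N * (B - 1)] is strict, and
     period [q.+1] exists. *)
  have : (q * N < (B - 1) * N)%N by lia.
  by rewrite ltn_pmul2r //; lia.
have iL : (m1 < N * B)%N by nia.
have jL : (m2 + b * N < N * B)%N by nia.
exists (Ordinal iL), (Ordinal jL); split=> //; apply/periodic_setP.
  by exists m1 => //; exists 0%N; rewrite //= addn0.
by exists m2 => //; exists b.
Qed.

End PeriodicSet.

Theorem theorem8 (R : realType) (N B d : nat)
    (hN : (1 <= N)%N) (hB : (1 <= B)%N) (hd : (N <= d <= N * (B - 1))%N)
    (M : {set 'I_N}) :
  set_covariance_sampler (banded_basis R (N * B) d) (periodic_set B M) <->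
  circular_sparse_ruler M.
Proof.
have dL : (d < N * B)%N by nia.
by rewrite set_covariance_samplerP // periodic_set_lags.
Qed.
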